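(* Let $G=(V,\vec E,b)$ be a directed weighted graph with vertex measure $m$ satisfying the standing assumptions listed in the context (including Assumption $(\beta)$), and let $\Omega\subset V$ be non-empty. Then $$\frac{h^{2}(\Omega)}{8}\;\le\; M_\Omega\,\nu(\Delta^{D}_\Omega)\;\le\;\frac12\, M_\Omega\, h(\Omega),$$ where $h(\Omega)$ is the Cheeger constant of $\Omega$, $M_\Omega=\sup_{x\in\Omega}\beta^+(x)/m(x)$, and $\nu(\Delta^D_\Omega)=\inf\{\mathrm{Re}\,\lambda:\lambda\in W(\Delta^D_\Omega)\}$ is the bottom of the real part of the numerical range of the Dirichlet Laplacian $\Delta^D_\Omega$.
   Context: A directed weighted graph is $G=(V,\vec E,b)$ with $V$ a countable vertex set and $b:V\times V\to[0,\infty)$ satisfying $b(x,x)=0$ for all $x$ and $b(x,y)>0$ iff $(x,y)\in\vec E$; it carries a measure $m:V\to(0,\infty)$. Put $\beta^+(x)=\sum_{y\in V}b(x,y)$ and $\beta^-(x)=\sum_{y\in V}b(y,x)$. Standing assumptions: $G$ is locally finite (each $x$ has only finitely many $y$ with $b(x,y)>0$ or $b(y,x)>0$); $\beta^+(x)>0$ and $\beta^-(x)>0$ for all $x$; Assumption $(\beta)$: $\beta^+(x)=\beta^-(x)$ for all $x\in V$; $G$ is connected, i.e. any two distinct vertices are related by a path, in one of the two directions (a path from $x$ to $y$ is a finite sequence of directed edges $(x_1,y_1),\dots,(x_n,y_n)\in\vec E$, $n\ge2$, with $x_1=x$, $y_n=y$, $x_i=y_{i-1}$ for $2\le i\le n$).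 $\mathcal C_c(U)$ is the space of finitely supported functions $U\to\mathbb C$. $\ell^2(V,m)$ has inner product $(f,g)_m=\sum_x m(x)f(x)\overline{g(x)}$ (similarly $\ell^2(\Omega,m)$). The Laplacian on $\mathcal C_c(V)$ is $\Delta f(x)=\frac1{m(x)}\sum_{y}b(x,y)(f(x)-f(y))$. For $\Omega\subset V$, the Dirichlet Laplacian $\Delta^D_\Omega$ with domain $\mathcal C_c(\Omega)$ is $\Delta^D_\Omega f=(\Delta g)|_\Omega$, where $g$ is the extension of $f$ by $0$ to $V$. The numerical range is $W(T)=\{(Tf,f): f\in D(T),\ \|f\|=1\}$, with the inner product and norm of $\ell^2(\Omega,m)$ here. The edge boundary of $U\subset V$ is $\partial_E U=\{(x,y)\in\vec E: (x\in U,y\in U^c)\text{ or }(x\in U^c,y\in U)\}$, $b(\partial_EU)=\sum_{(x,y)\in\partial_EU}b(x,y)$, $m(U)=\sum_{x\in U}m(x)$, and $$h(\Omega)=\inf_{\emptyset\ne U\subset\Omega,\ U\text{ finite}}\frac{b(\partial_EU)}{m(U)}.$$ $M_\Omega\in(0,\infty]$; if $M_\Omega=\infty$, products $M_\Omega\cdot t$ with $t\in[0,\infty]$ are read as $\infty$ (also for $t=0$). *)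

(* Defs.v *)
From HB Require Import structures.
From mathcomp Require Import all_boot all_order all_algebra.
From mathcomp Require Import complex.
From mathcomp Require Import boolp classical_sets cardinality fsbigop.
From mathcomp Require Import reals ereal.

Set Implicit Arguments.
Unset Strict Implicit.
Unset Printing Implicit Defensive.

Import Order.TTheory GRing.Theory Num.Theory.

Local Open Scope classical_set_scope.
Local Open Scope ring_scope.
Local Open Scope complex_scope.

(* All sums over sets of vertices or edges are the finitary sums of fsbigop,
   which return 0 when the summand has infinite support. In a locally finite
   graph, with finite vertex sets U and finitely supported functions, every sum
   below has finite support, so this default value is never used. *)

Record wdigraph (R : realType) := WDigraph {
  vertex :> countType;
  edge : set (vertex * vertex);
  weight : vertex -> vertex -> R;
  weight_ge0 : forall x y, 0 <= weight x y;
  weight_diag : forall x, weight x x = 0;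
  weight_gt0 : forall x y, 0 < weight x y <-> edge (x, y)
}.

Section Graph.
Variables (R : realType) (G : wdigraph R).

Definition locally_finite : Prop :=
  forall x : G, finite_set [set y | 0 < weight x y \/ 0 < weight y x].

Definition beta_out (x : G) : R := \sum_(y \in [set: G]) weight x y.

Definition beta_in (x : G) : R := \sum_(y \in [set: G]) weight y x.

(* [p] lists the edges (x_1,y_1), ..., (x_n,y_n) of the path, with n >= 2. *)
Definition dipath (x y : G) (p : seq (G * G)) : Prop :=
  [/\ (2 <= size p)%N,
      forall e, e \in p -> edge e,
      (head (x, y) p).1 = x,
      (last (x, y) p).2 = y
    & sorted (fun e e' : G * G => e'.1 == e.2) p].

Definition connected_digraph : Prop :=
  forall x y : G, x <> y -> (exists p, dipath x y p) \/ (exists p, dipath y x p).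

Definition edge_boundary (U : set G) : set (G * G) :=
  [set e | edge e /\ ((U e.1 /\ ~ U e.2) \/ (~ U e.1 /\ U e.2))].

Definition boundary_weight (U : set G) : R :=
  \sum_(e \in edge_boundary U) weight e.1 e.2.

Definition vol (m : G -> R) (U : set G) : R := \sum_(x \in U) m x.

Definition cheeger (m : G -> R) (Omega : set G) : \bar R :=
  ereal_inf [set (boundary_weight U / vol m U)%:E | U in
    [set U : set G | [/\ U !=set0, U `<=` Omega & finite_set U]]].

Definition max_degree (m : G -> R) (Omega : set G) : \bar R :=
  ereal_sup [set (beta_out x / m x)%:E | x in Omega].

End Graph.

Section HilbertSpace.
Variables (R : realType) (S : choiceType) (m : S -> R).

Definition Cc : set (S -> R[i]) := [set f | finite_set [set x | f x != 0]].

Definition l2dot (f g : S -> R[i]) : R[i] :=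
  \sum_(x \in [set: S]) (m x)%:C * f x * (g x)^*.

Definition l2norm (f : S -> R[i]) : R := Num.sqrt (complex.Re (l2dot f f)).

Definition numerical_range (D : set (S -> R[i]))
    (T : (S -> R[i]) -> (S -> R[i])) : set R[i] :=
  [set l2dot (T f) f | f in [set f | D f /\ l2norm f = 1]].

Definition nu (D : set (S -> R[i])) (T : (S -> R[i]) -> (S -> R[i])) : \bar R :=
  ereal_inf [set (complex.Re l)%:E | l in numerical_range D T].

End HilbertSpace.

Section Laplacian.
Variables (R : realType) (G : wdigraph R) (m : G -> R).

Definition laplacian (f : G -> R[i]) (x : G) : R[i] :=
  ((m x)^-1)%:C * \sum_(y \in [set: G]) (weight x y)%:C * (f x - f y).

Definition ext0 (Omega : set G) (f : set_type Omega -> R[i]) (x : G) : R[i] :=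
  oapp f 0 (insub x : option (set_type Omega)).

Definition dirichlet_laplacian (Omega : set G) (f : set_type Omega -> R[i])
    (x : set_type Omega) : R[i] :=
  laplacian (ext0 f) (val x).

Definition nu_dirichlet (Omega : set G) : \bar R :=
  nu (fun x : set_type Omega => m (val x)) (@Cc R (set_type Omega))
     (@dirichlet_laplacian Omega).

End Laplacian.

(* Product M * t in which M = +oo gives +oo even for t = 0; the library product
   has +oo * 0 = 0. *)
Definition mul_top (R : realType) (M t : \bar R) : \bar R :=
  if M == +oo%E then +oo%E else (M * t)%E.

(* Main.v *)
(** Since in- and out-degrees agree, Green's formula gives
    [2 Re (Delta f, f) = energy f], the sum of [b x y * `|f x - f y|^2]. For the
    indicator of [U] this is [b(dU)], hence the upper bound. For the lower bound
    put [w = `|f|^2]. The coarea inequality bounds [h * m(w)] by the total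
    variation of [w], the sum of [b x y * `|w x - w y|], and AM-GM bounds [2 t]
    times the latter by [energy f + 4 t^2 M * m(w)]; take [t = h / (4 M)].
    As [f] has finite support, all sums run over a finite sequence of vertices
    that contains the support together with its neighbours. *)
Require Import Defs.
From HB Require Import structures.
From mathcomp Require Import all_boot all_order all_algebra.
From mathcomp Require Import complex.
From mathcomp Require Import boolp classical_sets cardinality fsbigop.
From mathcomp Require Import reals ereal.
From mathcomp Require Import ring lra.

Set Implicit Arguments.
Unset Strict Implicit.
Unset Printing Implicit Defensive.

Import Order.TTheory GRing.Theory Num.Theory.

Local Open Scope classical_set_scope.
Local Open Scope ring_scope.

Section LayerCake.
Variable R : realDomainType.
Implicit Types (a t : R) (cs : seq (R * R)).

Definition unit_step t a : R := (t <= a)%R%:R.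

Lemma unit_step_mono t : {homo unit_step t : a a' / a <= a'}.
Proof.
move=> a a' aa'; rewrite /unit_step; have [ta|_] := leP t a; last exact: ler0n.
by rewrite (le_trans ta aa').
Qed.

(* The pair [(c, t)] stands for a layer of height [c] over the superlevel set
   at [t]. *)
Definition layer_sum cs a : R := \sum_(c <- cs) c.1 * unit_step c.2 a.

Lemma path_layer_sum t (ts : seq R) : path <%R t ts ->
  exists2 cs, {in cs, forall c, 0 <= c.1 /\ t < c.2} &
    {in t :: ts, forall a, layer_sum cs a = a - t}.
Proof.
elim: ts t => [|t' ts IHts] t /=.
  move=> _; exists [::] => // a /[!inE] /eqP ->.
  by rewrite /layer_sum big_nil subrr.
move=> /andP[tt' t'_ts]; have [cs cs_gt csE] := IHts _ t'_ts.
exists ((t' - t, t') :: cs).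
  move=> c /[!inE] /predU1P[->/=|/cs_gt[c1 c2]].
    by rewrite subr_ge0 ltW.
  by split=> //; exact: lt_trans tt' c2.
move=> a; rewrite inE /layer_sum big_cons /= => /predU1P[->|a_ts].
  rewrite /unit_step leNgt tt' mulr0 add0r subrr big1_seq//.
  by move=> c /andP[_ /cs_gt[_ c2]]; rewrite leNgt (lt_trans tt' c2) mulr0.
have t'a : t' <= a.
  move: a_ts; rewrite inE => /predU1P[->//|]; apply: allP a.
  by have := order_path_min le_trans (sub_path ltW t'_ts).
by rewrite /unit_step t'a mulr1 -/(layer_sum cs a) csE// addrC addrA subrK.
Qed.

Lemma layer_sum_exists (vs : seq R) : {in vs, forall a, 0 <= a} ->
  exists2 cs, {in cs, forall c, 0 <= c.1 /\ 0 < c.2} &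
    {in vs, forall a, a = layer_sum cs a}.
Proof.
move=> vs_ge0; pose ts := sort <=%R (undup [seq a <- vs | 0 < a]).
have mem_ts a : (a \in ts) = (0 < a) && (a \in vs).
  by rewrite mem_sort mem_undup mem_filter.
have /path_layer_sum[cs cs_gt0 csE] : path <%R 0 ts.
  rewrite path_min_sorted ?sort_lt_sorted ?undup_uniq//.
  by apply/allP => a; rewrite mem_ts => /andP[].
exists cs => // a a_vs; rewrite csE ?subr0//.
by rewrite inE mem_ts a_vs andbT -le0r vs_ge0.
Qed.

Lemma dist_layer_sum cs a a' : {in cs, forall c, 0 <= c.1} ->
  `|layer_sum cs a - layer_sum cs a'| =
  \sum_(c <- cs) c.1 * `|unit_step c.2 a - unit_step c.2 a'|.
Proof.
move=> cs_ge0; wlog a'a : a a' / a' <= a.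
  move=> dist_le; have [/dist_le//|/ltW/dist_le] := leP a' a.
  by rewrite distrC => ->; under eq_bigr do rewrite distrC.
have step_le t : 0 <= unit_step t a - unit_step t a'.
  by rewrite subr_ge0 unit_step_mono.
rewrite -sumrB ger0_norm.
  by apply: eq_bigr => c _; rewrite -mulrBr ger0_norm.
rewrite big_seq sumr_ge0// => c /cs_ge0 c1_ge0.
by rewrite -mulrBr mulr_ge0.
Qed.

End LayerCake.

Lemma dist_natr_bool (R : numDomainType) (p q : bool) :
  `|p%:R - q%:R| = (p (+) q)%:R :> R.
Proof.
case: p q => [] [] /=;
  by rewrite ?(subrr, subr0, sub0r, normrN, normr0, normr1).
Qed.

Section WeightedSums.
Variables (R : realFieldType) (T : eqType) (b : T -> T -> R) (s : seq T).

Definition total_variation (V : normedZmodType R) (f : T -> V) : R :=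
  \sum_(x <- s) \sum_(y <- s) b x y * `|f x - f y|.

Definition energy (V : normedZmodType R) (f : T -> V) : R :=
  \sum_(x <- s) \sum_(y <- s) b x y * `|f x - f y| ^+ 2.

Definition balanced_at (x : T) : Prop :=
  \sum_(y <- s) b x y = \sum_(y <- s) b y x.

Lemma sum_balanced (w : T -> R) :
  {in s, forall x, w x != 0 -> balanced_at x} ->
  \sum_(x <- s) \sum_(y <- s) b x y * w y =
  \sum_(x <- s) \sum_(y <- s) b x y * w x.
Proof.
move=> bal; rewrite exchange_big; apply: eq_big_seq => x xs /=.
rewrite -!mulr_suml; have [->|wx] := eqVneq (w x) 0; first by rewrite !mulr0.
by rewrite bal.
Qed.

Hypothesis b_ge0 : forall x y, 0 <= b x y.

Lemma coarea_le (m g : T -> R) (h : R) : {in s, forall x, 0 <= g x} ->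
  (forall t, 0 < t -> h * \sum_(x <- s) m x * unit_step t (g x) <=
     total_variation (unit_step t \o g)) ->
  h * \sum_(x <- s) m x * g x <= total_variation g.
Proof.
move=> g_ge0 h_le.
have [|cs cs_gt0 csE] := @layer_sum_exists _ [seq g x | x <- s].
  by move=> _ /mapP[x xs ->]; exact: g_ge0.
have {}csE x : x \in s -> g x = layer_sum cs (g x).
  by move=> xs; exact/csE/map_f.
have -> : \sum_(x <- s) m x * g x =
    \sum_(c <- cs) c.1 * \sum_(x <- s) m x * unit_step c.2 (g x).
  under [RHS]eq_bigr do rewrite mulr_sumr; rewrite exchange_big /=.
  apply: eq_big_seq => x /csE {1}->; rewrite mulr_sumr.
  by apply: eq_bigr => c _; rewrite mulrCA.
have -> : total_variation g =
    \sum_(c <- cs) c.1 * total_variation (unit_step c.2 \o g).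
  under [RHS]eq_bigr do rewrite mulr_sumr; rewrite exchange_big /=.
  apply: eq_big_seq => x xs; under [RHS]eq_bigr do rewrite mulr_sumr.
  rewrite exchange_big /=; apply: eq_big_seq => y ys.
  rewrite [X in `|X - _|]csE// [X in `|_ - X|]csE// dist_layer_sum.
    by rewrite mulr_sumr; apply: eq_bigr => c _; rewrite mulrCA.
  by move=> c /cs_gt0[].
rewrite mulr_sumr big_seq [leRHS]big_seq; apply: ler_sum => c /cs_gt0[c1 c2].
by rewrite mulrCA ler_wpM2l// h_le.
Qed.

(* AM-GM: with [d = `|p - q|] and [a = `|p| + `|q|], [`| `|p|^2 - `|q|^2|] is at
   most [d a], and [2 t d a <= d^2 + t^2 a^2]. *)
Lemma dist_sqr_norm_le (V : normedZmodType R) (p q : V) (t : R) : 0 <= t ->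
  2 * t * `| `|p| ^+ 2 - `|q| ^+ 2| <=
  `|p - q| ^+ 2 + 2 * t ^+ 2 * (`|p| ^+ 2 + `|q| ^+ 2).
Proof.
move=> t_ge0.
have /(ler_wpM2l (mulr_ge0 (ler0n R 2) t_ge0)) :
    `| `|p| ^+ 2 - `|q| ^+ 2| <= `|p - q| * (`|p| + `|q|).
  rewrite subr_sqr normrM [X in _ * X]ger0_norm ?addr_ge0//.
  by rewrite ler_wpM2r ?addr_ge0// ler_dist_dist.
move=> /le_trans; apply; rewrite -subr_ge0.
have -> : `|p - q| ^+ 2 + 2 * t ^+ 2 * (`|p| ^+ 2 + `|q| ^+ 2)
    - 2 * t * (`|p - q| * (`|p| + `|q|)) =
    (`|p - q| - t * (`|p| + `|q|)) ^+ 2 + (t * (`|p| - `|q|)) ^+ 2 by ring.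
by rewrite addr_ge0 ?sqr_ge0.
Qed.

Lemma total_variation_sqr_norm_le (V : normedZmodType R) (f : T -> V) (t : R) :
  {in s, forall x, f x != 0 -> balanced_at x} -> 0 <= t ->
  2 * t * total_variation (fun x => `|f x| ^+ 2) <=
  energy f + 4 * t ^+ 2 * \sum_(x <- s) (\sum_(y <- s) b x y) * `|f x| ^+ 2.
Proof.
move=> bal t_ge0; set D := \sum_(x <- s) _ * _.
have sum_out : \sum_(x <- s) \sum_(y <- s) b x y * `|f x| ^+ 2 = D.
  by apply: eq_bigr => x _; rewrite mulr_suml.
have sum_in : \sum_(x <- s) \sum_(y <- s) b x y * `|f y| ^+ 2 = D.
  rewrite (sum_balanced (w := fun x => `|f x| ^+ 2)) ?sum_out// => x xs.
  by rewrite sqrf_eq0 normr_eq0; exact: bal.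
have -> : 4 * t ^+ 2 * D = 2 * t ^+ 2 * (D + D) by ring.
rewrite -{1}sum_out -sum_in -big_split !mulr_sumr -big_split.
apply: ler_sum => x _ /=; rewrite -big_split !mulr_sumr -big_split.
apply: ler_sum => y _ /=.
rewrite -mulrDr mulrCA [2 * _ * (b x y * _)]mulrCA -mulrDr.
by rewrite ler_wpM2l// dist_sqr_norm_le.
Qed.

Lemma cheeger_energy_le (V : normedZmodType R) (m : T -> R) (f : T -> V)
    (h M : R) : 0 <= h -> 0 < M ->
  {in s, forall x, f x != 0 -> balanced_at x} ->
  {in s, forall x, f x != 0 -> \sum_(y <- s) b x y <= M * m x} ->
  (forall t, 0 < t -> h * \sum_(x <- s) m x * unit_step t (`|f x| ^+ 2) <=
     total_variation (fun x => unit_step t (`|f x| ^+ 2))) ->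
  h ^+ 2 * \sum_(x <- s) m x * `|f x| ^+ 2 <= 4 * M * energy f.
Proof.
move=> h_ge0 M_gt0 bal deg_le h_le; set N := \sum_(x <- s) _.
have hN_le : h * N <= total_variation (fun x => `|f x| ^+ 2).
  by apply: coarea_le => // x _; rewrite exprn_ge0.
have degN_le : \sum_(x <- s) (\sum_(y <- s) b x y) * `|f x| ^+ 2 <= M * N.
  rewrite mulr_sumr big_seq [leRHS]big_seq; apply: ler_sum => x xs.
  have [->|fx] := eqVneq (f x) 0; first by rewrite normr0 expr0n /= !mulr0.
  by rewrite mulrA ler_wpM2r ?exprn_ge0 ?deg_le.
(* The AM-GM bound is optimal at this [t]. *)
pose t := h / (4 * M).
have t_ge0 : 0 <= t by rewrite divr_ge0// mulr_ge0// ltW.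
have energy_ge : 2 * t * (h * N) <= energy f + 4 * t ^+ 2 * (M * N).
  apply: le_trans (ler_wpM2l _ hN_le) _; first by rewrite mulr_ge0.
  apply: le_trans (total_variation_sqr_norm_le bal t_ge0) _.
  by rewrite lerD2l ler_wpM2l// mulr_ge0 ?sqr_ge0.
have := ler_wpM2l (ltW (mulr_gt0 (ltr0n R 4) M_gt0)) energy_ge.
have -> : 4 * M * (2 * t * (h * N)) = 2 * (h ^+ 2 * N).
  by rewrite /t; field; rewrite gt_eqF.
have -> : 4 * M * (energy f + 4 * t ^+ 2 * (M * N)) =
    4 * M * energy f + h ^+ 2 * N.
  by rewrite /t; field; rewrite gt_eqF.
lra.
Qed.

End WeightedSums.

(* [Rcomplex R] is [R[i]] normed by its [R]-valued modulus, whereas the norm of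
   [R[i]] takes values in [R[i]]. *)
Section ComplexEnergy.
Variable R : rcfType.
Implicit Types p q z : Rcomplex R.

Lemma sqr_norm_Rcomplex z : `|z| ^+ 2 = complex.Re z ^+ 2 + complex.Im z ^+ 2.
Proof. by case: z => a b; rewrite sqr_sqrtr ?addr_ge0 ?sqr_ge0. Qed.

Lemma Re_mul_conj z : complex.Re (z * (z : R[i])^*) = `|z| ^+ 2.
Proof. by rewrite sqr_norm_Rcomplex; case: z => a b /=; ring. Qed.

Lemma Re_subr_mul_conj p q : complex.Re ((p - q) * (p : R[i])^*) =
  2^-1 * (`|p - q| ^+ 2 + (`|p| ^+ 2 - `|q| ^+ 2)).
Proof.
by rewrite !sqr_norm_Rcomplex; case: p q => [a b] [a' b'] /=; field.
Qed.

Lemma Re_real_mul (k : R) z : complex.Re (k%:C%C * z) = k * complex.Re z.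
Proof. by case: z => a b /=; rewrite mul0r subr0. Qed.

Lemma green_energy (T : eqType) (b : T -> T -> R) (s : seq T)
    (f : T -> Rcomplex R) :
  {in s, forall x, f x != 0 -> balanced_at b s x} ->
  \sum_(x <- s) \sum_(y <- s)
     b x y * complex.Re ((f x - f y) * (f x : R[i])^*) =
  2^-1 * energy b s f.
Proof.
move=> bal; pose w x := `|f x| ^+ 2.
transitivity (2^-1 * (energy b s f +
    (\sum_(x <- s) \sum_(y <- s) b x y * w x
     - \sum_(x <- s) \sum_(y <- s) b x y * w y))).
  rewrite -sumrB -big_split mulr_sumr; apply: eq_bigr => x _ /=.
  rewrite -sumrB -big_split mulr_sumr; apply: eq_bigr => y _ /=.
  by rewrite Re_subr_mul_conj /w; ring.
rewrite sum_balanced ?subrr ?addr0// => x xs.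
by rewrite sqrf_eq0 normr_eq0; exact: bal.
Qed.

Lemma energy_indicator (T : eqType) (b : T -> T -> R) (s : seq T)
    (P : pred T) :
  energy b s (fun x => (P x)%:R : Rcomplex R) =
  total_variation b s (fun x => (P x)%:R : R).
Proof.
apply: eq_bigr => x _; apply: eq_bigr => y _; congr (_ * _).
rewrite sqr_norm_Rcomplex dist_natr_bool.
by case: (P x) (P y) => [] [] /=; ring.
Qed.

End ComplexEnergy.

Section FinitarySums.
Variables (R : Type) (idx : R) (op : Monoid.com_law idx) (T : choiceType).

Lemma fsbig_set_type (A : set T) (F : T -> R) :
  \big[op/idx]_(x \in [set: set_type A]) F (val x) =
  \big[op/idx]_(x \in A) F x.
Proof.
rewrite [RHS](reindex_fsbig (val : set_type A -> T) [set: set_type A])//.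
split=> [x _|x y _ _|x Ax]; [exact: set_valP|exact: val_inj|].
by exists (exist _ x (mem_set Ax)).
Qed.

Lemma fsbigT_seq (s : seq T) (F : T -> R) : uniq s ->
  (forall x, x \notin s -> F x = idx) ->
  \big[op/idx]_(x \in [set: T]) F x = \big[op/idx]_(x <- s) F x.
Proof.
move=> us F0; rewrite (fsbigE s)//; last by move=> x _; exact: F0.
by apply: eq_bigl => x; rewrite in_setT.
Qed.

End FinitarySums.

Definition supp (S : Type) (V : nmodType) (f : S -> V) : set S :=
  [set x | f x != 0].

Lemma notin_supp (S : Type) (V : nmodType) (f : S -> V) (x : S) :
  ~ supp f x -> f x = 0.
Proof. by move=> /negP; rewrite negbK => /eqP. Qed.

Lemma supp_indicator (S : Type) (V : nzSemiRingType) (A : set S) :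
  supp (fun x => (x \in A)%:R : V) `<=` A.
Proof.
move=> x; rewrite /supp /=; have [/set_mem//|_] := boolP (x \in A).
by rewrite eqxx.
Qed.

Section HilbertSpace.
Variables (R : realType) (S : choiceType) (m : S -> R).
Implicit Types f g : S -> Rcomplex R.

Lemma l2dotZ (k : R) f g :
  l2dot m (fun x => k%:C%C * f x) (fun x => k%:C%C * g x) =
  (k ^+ 2)%:C%C * l2dot m f g.
Proof.
rewrite /l2dot mulr_fsumr; apply: eq_fsbigr => x _.
by case: (f x) (g x) => [a b] [a' b'] /=; congr Complex; ring.
Qed.

Lemma l2normZ (k : R) f : l2norm m (fun x => k%:C%C * f x) = `|k| * l2norm m f.
Proof.
by rewrite /l2norm l2dotZ Re_real_mul sqrtrM ?sqr_ge0// sqrtr_sqr.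
Qed.

Lemma l2dot_set_type (A : set S) f g : supp g `<=` A ->
  l2dot (fun x : set_type A => m (val x)) (f \o val) (g \o val) = l2dot m f g.
Proof.
move=> gA; pose F x := (m x)%:C%C * f x * (g x : R[i])^*.
rewrite /l2dot (fsbig_set_type _ A F).
apply: fsbig_widen => // x [_ Ax] /=.
by rewrite /F [g x]notin_supp ?conjC0 ?mulr0// => /gA.
Qed.

Lemma sqr_l2norm_seq (s : seq S) f : (forall x, 0 <= m x) ->
  uniq s -> (forall x, supp f x -> x \in s) ->
  l2norm m f ^+ 2 = \sum_(x <- s) m x * `|f x| ^+ 2.
Proof.
move=> m_ge0 us fs.
have normE : complex.Re (l2dot m f f) = \sum_(x <- s) m x * `|f x| ^+ 2.
  rewrite /l2dot (fsbigT_seq _ us) => [|x xs].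
    rewrite raddf_sum; apply: eq_bigr => x _ /=.
    by rewrite -mulrA Re_real_mul Re_mul_conj.
  have -> : f x = 0 :> R[i] by apply: notin_supp => /fs; rewrite (negPf xs).
  by rewrite mulr0 mul0r.
rewrite sqr_sqrtr normE// sumr_ge0// => x _.
by rewrite mulr_ge0 ?exprn_ge0.
Qed.

End HilbertSpace.

Section Neighbourhoods.
Variables (R : realType) (G : wdigraph R).

Definition adjacent (x y : G) : Prop := 0 < weight x y \/ 0 < weight y x.

Definition seq_interior (s : seq G) : set G :=
  [set x | x \in s /\ forall y, adjacent x y -> y \in s].

Lemma seq_interior_exists (A : set G) : locally_finite G -> finite_set A ->
  exists2 s, uniq s & A `<=` seq_interior s.
Proof.
move=> G_lf A_fin.
have : finite_set (A `|` \bigcup_(x in A) [set y | adjacent x y]).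
  rewrite finite_setU; split=> //; apply: bigcup_finite => // x _.
  exact: G_lf.
move=> /finite_seqP[s sE]; exists (undup s); first exact: undup_uniq.
have mem_s y : (A `|` \bigcup_(x in A) [set y | adjacent x y]) y ->
    y \in undup s by rewrite sE mem_undup.
move=> x Ax; split=> [|y xy]; apply: mem_s; first by left.
by right; exists x.
Qed.

Section Interior.
Variables (s : seq G) (us : uniq s).

Lemma weight_notin_seq (x y : G) : seq_interior s x -> y \notin s ->
  weight x y = 0 /\ weight y x = 0.
Proof.
move=> [_ x_nbhd] /negP ys; split; apply/eqP;
  rewrite eq_le weight_ge0 andbT leNgt; apply/negP => w_gt0; apply/ys/x_nbhd.
  by left.
by right.
Qed.

Lemma beta_out_seq (x : G) : seq_interior s x ->
  beta_out x = \sum_(y <- s) weight x y.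
Proof. by move=> xs; apply: fsbigT_seq => // y /(weight_notin_seq xs)[]. Qed.

Lemma beta_in_seq (x : G) : seq_interior s x ->
  beta_in x = \sum_(y <- s) weight y x.
Proof. by move=> xs; apply: fsbigT_seq => // y /(weight_notin_seq xs)[]. Qed.

Lemma vol_seq (m : G -> R) (U : set G) : (forall x, U x -> x \in s) ->
  vol m U = \sum_(x <- s) m x * (x \in U)%:R.
Proof.
move=> Us; rewrite /vol -[U in LHS]setTI fsbig_mkcondr.
rewrite (fsbigT_seq _ us) => [|x xs].
  by apply: eq_bigr => x _; rewrite mulr_natr mulrb.
by rewrite memNset// => /Us; exact/negP.
Qed.

Lemma mem_edge_boundary (U : set G) (x y : G) :
  ((x, y) \in edge_boundary U) =
  (0 < weight x y) && ((x \in U) (+) (y \in U)).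
Proof.
apply/idP/andP => [/set_mem[/weight_gt0 w_gt0 xyU]|[w_gt0 xyU]].
  split=> //; case: xyU => -[/= Ux Uy].
    by rewrite (mem_set Ux) (memNset Uy).
  by rewrite (memNset Ux) (mem_set Uy).
rewrite inE; split; first exact/weight_gt0.
move: xyU; have [Ux|/negP Ux] := boolP (x \in U);
  have [Uy|/negP Uy] := boolP (y \in U) => //= _; rewrite !inE in Ux Uy.
  by left.
by right.
Qed.

Lemma boundary_weight_seq (U : set G) : U `<=` seq_interior s ->
  boundary_weight U =
  total_variation (@weight R G) s (fun x => (x \in U)%:R : R).
Proof.
move=> Us; rewrite /boundary_weight -[edge_boundary U]setTI fsbig_mkcondr.
have uss : uniq [seq (x, y) | x <- s, y <- s].
  by apply: allpairs_uniq => // -[x y] [x' y'].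
rewrite (fsbigT_seq _ uss).
  rewrite big_allpairs; apply: eq_bigr => x _; apply: eq_bigr => y _ /=.
  rewrite mem_edge_boundary; have := weight_ge0 x y.
  rewrite le_eqVlt => /predU1P[<-|->]; first by rewrite mul0r if_same.
  by rewrite dist_natr_bool mulr_natr mulrb.
move=> [x y]; rewrite mem_edge_boundary.
case: ifP => // /andP[w_gt0 xyU] /negP[]; apply/allpairsP; exists (x, y).
move: xyU; have [/set_mem/Us[xs x_nbhd] _|_ /= /set_mem/Us[ys y_nbhd]] :=
  boolP (x \in U).
  by split=> //; apply: x_nbhd; left.
by split=> //; apply: y_nbhd; right.
Qed.

End Interior.
End Neighbourhoods.

Section DirichletForm.
Variables (R : realType) (G : wdigraph R) (m : G -> R).
Hypothesis m_gt0 : forall x, 0 < m x.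
Implicit Types (f : G -> Rcomplex R) (Omega U : set G).

Definition dirichlet_form f : R := complex.Re (l2dot m (laplacian m f) f).

Lemma laplacianZ (k : R) f :
  laplacian m (fun x => k%:C%C * f x) = fun x => k%:C%C * laplacian m f x.
Proof.
apply/funext => x; rewrite /laplacian mulrCA; congr (_ * _).
rewrite mulr_fsumr; apply: eq_fsbigr => y _.
by rewrite -mulrBr mulrCA.
Qed.

Lemma dirichlet_formZ (k : R) f :
  dirichlet_form (fun x => k%:C%C * f x) = k ^+ 2 * dirichlet_form f.
Proof. by rewrite /dirichlet_form laplacianZ l2dotZ Re_real_mul. Qed.

Lemma nu_dirichletE Omega :
  nu_dirichlet m Omega =
  nu m [set f | Cc f /\ supp f `<=` Omega] (laplacian m).
Proof.
have ext0K (f : set_type Omega -> Rcomplex R) : ext0 f \o val = f.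
  by apply/funext => x; rewrite /= /ext0 valK.
have supp_ext0 (f : set_type Omega -> Rcomplex R) :
    supp (ext0 f) `<=` val @` supp f.
  move=> x; rewrite /supp /ext0 /=.
  by case: insubP => [y _ <- fy|_ /=]; [exists y|rewrite eqxx].
have ext0_sub (f : set_type Omega -> Rcomplex R) : supp (ext0 f) `<=` Omega.
  by move=> _ /supp_ext0[y _ <-]; exact: set_valP.
have restrK f : supp f `<=` Omega -> ext0 (f \o val : set_type Omega -> _) = f.
  move=> fO; apply/funext => x; rewrite /ext0.
  case: insubP => [y _ <- //|xO] /=.
  by apply/esym/notin_supp => /fO/mem_set; rewrite (negPf xO).
have dotE (f g : G -> Rcomplex R) := l2dot_set_type m (A := Omega) f (g := g).
congr (ereal_inf [set _ | l in _]); apply/seteqP; split.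
  move=> _ [f [f_Cc f_norm1] <-]; exists (ext0 f).
    split; last by rewrite /l2norm -dotE ?ext0K.
    split; last exact: ext0_sub.
    exact: sub_finite_set (supp_ext0 f) (finite_image val f_Cc).
  by rewrite -dotE ?ext0K.
move=> _ [f [[f_Cc fO] f_norm1] <-]; exists (f \o val).
  split; last by rewrite /l2norm dotE.
  by apply: finite_preimage f_Cc => x y _ _; exact: val_inj.
by rewrite -dotE // /dirichlet_laplacian restrK.
Qed.

Lemma nu_dirichlet_le_rayleigh Omega f : Cc f -> supp f `<=` Omega ->
  0 < l2norm m f ->
  (nu_dirichlet m Omega <= (dirichlet_form f / l2norm m f ^+ 2)%:E)%E.
Proof.
move=> f_Cc fO f_norm; rewrite nu_dirichletE; apply: ereal_inf_lbound.
pose k := (l2norm m f)^-1; pose g x := k%:C%C * f x.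
have gf : supp g `<=` supp f.
  by move=> x; apply: contra_neq => fx; rewrite /g fx mulr0.
exists (l2dot m (laplacian m g) g); last first.
  by rewrite -/(dirichlet_form g) dirichlet_formZ exprVn mulrC.
exists g => //; split; first split.
- exact: sub_finite_set gf f_Cc.
- exact: subset_trans gf fO.
by rewrite l2normZ ger0_norm ?invr_ge0 ?ltW// mulVf ?gt_eqF.
Qed.

Hypothesis beta_eq : forall x : G, beta_out x = beta_in x.

Lemma balanced_at_interior (s : seq G) (x : G) : uniq s -> seq_interior s x ->
  balanced_at (@weight R G) s x.
Proof.
by move=> us xs; rewrite /balanced_at -beta_out_seq// -beta_in_seq.
Qed.

Lemma dirichlet_form_seq (s : seq G) f : uniq s -> supp f `<=` seq_interior s ->
  dirichlet_form f = 2^-1 * energy (@weight R G) s f.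
Proof.
move=> us fs; rewrite -green_energy; last first.
  by move=> x _ fx; apply: balanced_at_interior => //; exact: fs.
have f0 x : ~ seq_interior s x -> f x = 0 :> R[i].
  by move=> xs; apply: notin_supp => /fs.
rewrite /dirichlet_form /l2dot (fsbigT_seq _ us) => [|x xs]; last first.
  by rewrite f0 ?conjC0 ?mulr0// => -[]; rewrite (negPf xs).
rewrite raddf_sum; apply: eq_bigr => x _ /=.
have [xs|/f0 fx0] := pselect (seq_interior s x); last first.
  by rewrite fx0 conjC0 mulr0 /= big1// => y _; rewrite mulr0 /= mulr0.
rewrite /laplacian (fsbigT_seq _ us) => [|y /(weight_notin_seq xs)[->]];
  last by rewrite mul0r.
rewrite mulrA -rmorphM /= divff ?gt_eqF// mul1r mulr_suml raddf_sum.
by apply: eq_bigr => y _ /=; rewrite -mulrA Re_real_mul.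
Qed.

End DirichletForm.

Section Cheeger.
Variables (R : realType) (G : wdigraph R) (m : G -> R).
Hypothesis m_gt0 : forall x, 0 < m x.
Implicit Types (f : G -> Rcomplex R) (Omega U : set G).

Lemma vol_gt0 U : U !=set0 -> finite_set U -> 0 < vol m U.
Proof.
move=> [x Ux] U_fin; rewrite /vol (fsbigD1 x)// ltr_pwDl//.
by rewrite sumr_ge0// => y _; exact: ltW.
Qed.

Lemma boundary_weight_ge0 U : 0 <= boundary_weight U.
Proof. by apply: sumr_ge0 => e _; exact: weight_ge0. Qed.

Lemma cheeger_ge0 Omega : (0 <= cheeger m Omega)%E.
Proof.
apply: le_ereal_inf_tmp => _ [U [U0 UO U_fin] <-].
by rewrite lee_fin divr_ge0 ?boundary_weight_ge0// ltW// vol_gt0.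
Qed.

Lemma cheeger_fin_num Omega : Omega !=set0 -> cheeger m Omega \is a fin_num.
Proof.
move=> [x Ox]; rewrite ge0_fin_numE ?cheeger_ge0//.
apply: le_lt_trans (ltry (boundary_weight [set x] / vol m [set x])).
apply: ereal_inf_lbound; exists [set x] => //.
by split=> //; [exists x|move=> _ ->].
Qed.

Lemma cheeger_vol_le Omega U : Omega !=set0 -> U `<=` Omega -> finite_set U ->
  fine (cheeger m Omega) * vol m U <= boundary_weight U.
Proof.
move=> O0 UO U_fin; have [->|/set0P U0] := eqVneq U set0.
  by rewrite /vol fsbig_set0 mulr0 boundary_weight_ge0.
rewrite -ler_pdivlMr ?vol_gt0// -lee_fin fineK ?cheeger_fin_num//.
by apply: ereal_inf_lbound; exists U.
Qed.

Lemma beta_out_le_max_degree Omega (x : G) :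
  max_degree m Omega \is a fin_num -> Omega x ->
  beta_out x <= fine (max_degree m Omega) * m x.
Proof.
move=> M_fin Ox; rewrite -ler_pdivrMr// -lee_fin fineK//.
by apply: ereal_sup_ubound; exists x.
Qed.

Lemma max_degree_gt0 Omega (x : G) : Omega x -> 0 < beta_out x ->
  (0 < max_degree m Omega)%E.
Proof.
move=> Ox beta_gt0; apply: (@lt_le_trans _ _ (beta_out x / m x)%:E).
  by rewrite lte_fin divr_gt0.
by apply: ereal_sup_ubound; exists x.
Qed.

Hypothesis G_lf : locally_finite G.
Hypothesis beta_eq : forall x : G, beta_out x = beta_in x.

Lemma dirichlet_form_indicator U : finite_set U ->
  dirichlet_form m (fun x => (x \in U)%:R) = 2^-1 * boundary_weight U.
Proof.
move=> U_fin; have [s us Us] := seq_interior_exists G_lf U_fin.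
rewrite (dirichlet_form_seq m_gt0 beta_eq us) ?(boundary_weight_seq us)//.
  by rewrite (energy_indicator _ _ (mem U)).
exact: subset_trans (@supp_indicator _ _ U) Us.
Qed.

Lemma sqr_l2norm_indicator U : finite_set U ->
  l2norm m (fun x => (x \in U)%:R) ^+ 2 = vol m U.
Proof.
move=> U_fin; have [s us Us] := seq_interior_exists G_lf U_fin.
have U_s x : U x -> x \in s by move=> /Us[].
rewrite (sqr_l2norm_seq _ us) => [|x|x Ux]; first 1 last.
- exact: ltW.
- exact/U_s/(supp_indicator Ux).
rewrite (vol_seq us)//; apply: eq_bigr => x _; congr (_ * _).
by rewrite sqr_norm_Rcomplex; case: (x \in U) => /=; ring.
Qed.

Lemma nu_dirichlet_le_cheeger Omega :
  (nu_dirichlet m Omega <= (2^-1)%:E * cheeger m Omega)%E.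
Proof.
rewrite lee_pdivlMl//; apply: le_ereal_inf_tmp => _ [U [U0 UO U_fin] <-].
pose f (x : G) : Rcomplex R := (x \in U)%:R.
have f_norm2 : l2norm m f ^+ 2 = vol m U by exact: sqr_l2norm_indicator.
have f_norm_gt0 : 0 < l2norm m f.
  by rewrite lt0r sqrtr_ge0 andbT -sqrf_eq0 f_norm2 gt_eqF ?vol_gt0.
have f_Cc : Cc f by exact: sub_finite_set (@supp_indicator _ _ U) U_fin.
have fO : supp f `<=` Omega by exact: subset_trans (@supp_indicator _ _ U) UO.
rewrite -lee_pdivlMl//.
apply: le_trans (nu_dirichlet_le_rayleigh f_Cc fO f_norm_gt0) _.
by rewrite f_norm2 dirichlet_form_indicator// -EFinM mulrA.
Qed.

Lemma cheeger_dirichlet_form_le f (h M : R) : 0 <= h -> 0 < M -> Cc f ->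
  (forall U, U `<=` supp f -> h * vol m U <= boundary_weight U) ->
  (forall x, supp f x -> beta_out x <= M * m x) ->
  h ^+ 2 * l2norm m f ^+ 2 <= 8 * M * dirichlet_form m f.
Proof.
move=> h_ge0 M_gt0 f_Cc h_le beta_le.
have [s us fs] := seq_interior_exists G_lf f_Cc.
rewrite (dirichlet_form_seq m_gt0 beta_eq us fs).
rewrite (sqr_l2norm_seq _ us) => [|x|x /fs[]//]; last exact: ltW.
have -> : 8 * M * (2^-1 * energy (@weight R G) s f) =
    4 * M * energy (@weight R G) s f by field.
apply: cheeger_energy_le => //.
- exact: weight_ge0.
- by move=> x _ /fs; exact: balanced_at_interior.
- by move=> x _ fx; rewrite -(beta_out_seq us (fs x fx)) beta_le.
move=> t t_gt0; pose U : set G := [set x | t <= `|f x| ^+ 2].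
have U_supp : U `<=` supp f.
  move=> x; rewrite /U /supp /=; apply: contraTneq => ->.
  by rewrite normr0 expr0n -ltNge.
have U_s := subset_trans U_supp fs.
have stepE x : unit_step t (`|f x| ^+ 2) = (x \in U)%:R.
  by rewrite /unit_step; congr (nat_of_bool _)%:R; apply/idP/idP; rewrite inE.
rewrite (funext stepE) -(boundary_weight_seq us U_s).
under eq_bigr do rewrite stepE.
by rewrite -(vol_seq us) => [|x /U_s[]//]; exact: h_le.
Qed.

Lemma cheeger_sqr_le_nu_dirichlet Omega : Omega !=set0 ->
  max_degree m Omega \is a fin_num -> (0 < max_degree m Omega)%E ->
  (cheeger m Omega ^+ 2 * (8^-1)%:E <=
   max_degree m Omega * nu_dirichlet m Omega)%E.
Proof.
move=> O0 M_fin M_gt0; rewrite nu_dirichletE//.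
have cheeger_fin := cheeger_fin_num O0.
have fine_M_gt0 : 0 < fine (max_degree m Omega).
  by rewrite fine_gt0// M_gt0 ltey_eq M_fin.
rewrite -(fineK M_fin) -(fineK cheeger_fin) -lee_pdivrMl//.
apply: le_ereal_inf_tmp => _ [_ [f [[f_Cc fO] f_norm1] <-] <-].
rewrite -EFin_expe -!EFinM lee_fin ler_pdivrMl// ler_pdivrMr//.
rewrite [leRHS]mulrC mulrA.
have := @cheeger_dirichlet_form_le
  f (fine (cheeger m Omega)) _ _ fine_M_gt0 f_Cc.
rewrite f_norm1 expr1n mulr1; apply.
- by rewrite fine_ge0 ?cheeger_ge0.
- move=> U Uf; apply: cheeger_vol_le => //; first exact: subset_trans Uf fO.
  exact: sub_finite_set Uf f_Cc.
- by move=> x /fO; exact: beta_out_le_max_degree.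
Qed.

End Cheeger.

Theorem theorem3p1 (R : realType) (G : wdigraph R) (m : G -> R)
    (m_gt0 : forall x : G, 0 < m x)
    (G_lf : locally_finite G)
    (beta_out_gt0 : forall x : G, 0 < beta_out x)
    (beta_in_gt0 : forall x : G, 0 < beta_in x)
    (beta_eq : forall x : G, beta_out x = beta_in x)
    (G_conn : connected_digraph G)
    (Omega : set G) (Omega_neq0 : Omega !=set0) :
  ((cheeger m Omega ^+ 2 * (8^-1)%:E
      <= mul_top (max_degree m Omega) (nu_dirichlet m Omega))%E
   /\ (mul_top (max_degree m Omega) (nu_dirichlet m Omega)
      <= (2^-1)%:E * mul_top (max_degree m Omega) (cheeger m Omega))%E).
Proof.
have M_gt0 : (0 < max_degree m Omega)%E.
  by have [x Ox] := Omega_neq0; exact: max_degree_gt0 Ox (beta_out_gt0 x).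
rewrite /mul_top; case: eqP => [_|/eqP M_neq_top].
  by split; [exact: leey|rewrite gt0_muley// lte_fin invr_gt0 ltr0n].
have M_fin : max_degree m Omega \is a fin_num by rewrite gt0_fin_numE// ltey.
split; first exact: cheeger_sqr_le_nu_dirichlet.
by rewrite muleCA lee_pmul2l// nu_dirichlet_le_cheeger.
Qed.
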